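(* For any two integers $n\ge 3$ and $p\ge 4$, $$f(\hat S_p^n)\ \ge\ \begin{cases} p^n-\dfrac{p^{n-1}}{8}+\dfrac{p^{n-2}+\cdots+p}{8}+\dfrac{5p}{8}, & \text{if } p \text{ is even},\\[2mm] p^n-\dfrac{p^{n-1}+p^{n-2}-5p+3}{8}, & \text{if } p \text{ is odd},\end{cases}$$ where $p^{n-2}+\cdots+p=\sum_{i=1}^{n-2}p^i$.
   Context: All graphs are simple, finite and undirected. For a graph $G$, $f(G)$ denotes the order (number of vertices) of a maximum induced forest of $G$, i.e. the maximum cardinality of a set $X\subseteq V(G)$ such that the induced subgraph $G[X]$ is a forest. For an integer $p\ge 1$ let $P=\{0,1,\ldots,p-1\}$, let $[n]=\{1,\ldots,n\}$, and let $P^n$ be the set of all $n$-tuples over $P$, written as words of length $n$ ($P^0$ consists of the empty word only); $j^{m}$ denotes the word consisting of $m$ copies of $j$. For integers $p\ge 1$, $n\ge 0$, the Sierpiński graph $S_p^n$ is given by $V(S_p^n)=P^n$ and $$E(S_p^n)=\{\{\underline{s}ij^{d-1},\underline{s}ji^{d-1}\} \mid i,j\in P,\ i\ne j,\ d\in[n],\ \underline{s}\in P^{n-d}\}.$$ For integers $p\ge 1$, $n\ge 0$, the generalized Sierpiński triangle graph $\hat S_p^n$ is obtained from $S_p^{n+1}$ by contracting all non-clique edges, i.e. all edges of the form $\{\underline{s}ij^{l},\underline{s}ji^{l}\}$ with distinct $i,j\in P$, $l\in[n]$, $\underline{s}\in P^{n-l}$. *)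

(* Defs.v *)
From mathcomp Require Import all_boot all_order all_algebra.

Set Implicit Arguments.
Unset Strict Implicit.
Unset Printing Implicit Defensive.

Record sgraph := SGraph {
  vertex :> finType;
  adj : rel vertex;
  adj_sym : symmetric adj;
  adj_irr : irreflexive adj
}.

(* [G[X]] is a forest: no cycle of length at least 3 runs inside [X].  The
   length is bounded by [#|G|] only to make this a boolean; see [forestP]. *)
Definition forest (G : sgraph) (X : {set G}) : bool :=
  [forall k : 'I_#|G|.+1, forall c : k.-tuple G,
     [&& ucycleb (@adj G) c & all (mem X) c] ==> (size c < 3)].

Lemma forestP (G : sgraph) (X : {set G}) :
  reflect (forall c : seq G, ucycle (@adj G) c -> {subset c <= X} ->
             size c < 3)
          (forest X).
Proof.
apply: (iffP forallP) => [H c cyc sub | H k].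
  have /andP[_ Uc] := cyc.
  have lt_c : size c < #|G|.+1 by rewrite ltnS -(card_uniqP Uc) max_card.
  have /forallP/(_ (in_tuple c))/implyP := H (Ordinal lt_c).
  by apply; apply/andP; split=> //; apply/allP.
apply/forallP => c; apply/implyP => /andP[cyc /allP sub].
exact: H.
Qed.

(* Order of a maximum induced forest. *)
Definition max_forest (G : sgraph) : nat :=
  \max_(X : {set G} | forest X) #|X|.

Section Contraction.
Variables (G : sgraph) (c : rel G).

(* Contraction of the edges [{x, y}] with [c x y], for a symmetric
   [c : rel G] included in the adjacency of [G]: the new vertices are the
   connected components of [(V(G), c)], and loops and parallel edges are
   discarded. *)
Definition contract_vertex :=
  {C : {set G} | C \in equivalence_partition (connect c) [set: G]}.

Definition contract_adj : rel contract_vertex := fun C D =>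
  (C != D) && [exists x in val C, exists y in val D, adj x y].

Fact contract_adj_sym : symmetric contract_adj.
Proof.
move=> C D; rewrite /contract_adj eq_sym; congr (_ && _).
by apply/idP/idP => /exists_inP[x xC /exists_inP[y yD xy]];
  apply/exists_inP; exists y => //; apply/exists_inP; exists x => //;
  rewrite adj_sym.
Qed.

Fact contract_adj_irr : irreflexive contract_adj.
Proof. by move=> C; rewrite /contract_adj eqxx. Qed.

Definition contract := SGraph contract_adj_sym contract_adj_irr.
End Contraction.

Section Sierpinski.
Variables p n : nat.

(* [x = s i j^l] and [y = s j i^l] for some [i != j] and some word [s] of
   length [n - l.+1]. *)
Definition sierp_link (l : nat) (x y : n.-tuple 'I_p) : bool :=
  [exists i : 'I_p, exists j : 'I_p, exists s : (n - l.+1).-tuple 'I_p,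
     [&& i != j,
         x == s ++ i :: nseq l j :> seq 'I_p &
         y == s ++ j :: nseq l i :> seq 'I_p]].

Definition sierp_adj : rel (n.-tuple 'I_p) := fun x y =>
  [exists d : 'I_n.+1, (1 <= d) && sierp_link d.-1 x y].

Fact sierp_link_sym l : symmetric (sierp_link l).
Proof.
by move=> x y; apply/idP/idP => /existsP[i /existsP[j /existsP[s /and3P[ij ex ey]]]];
  apply/existsP; exists j; apply/existsP; exists i; apply/existsP; exists s;
  rewrite eq_sym ij ex ey.
Qed.

Fact sierp_adj_sym : symmetric sierp_adj.
Proof. by move=> x y; apply: eq_existsb => d; rewrite sierp_link_sym. Qed.

Fact sierp_adj_irr : irreflexive sierp_adj.
Proof.
move=> x; apply/existsP => -[d /andP[_]].
move=> /existsP[i /existsP[j /existsP[s /and3P[/eqP ij /eqP ex /eqP]]]].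
by rewrite ex => /eqP; rewrite eqseq_cat // eqxx /= eqseq_cons => /andP[/eqP].
Qed.

Definition sierpinski := SGraph sierp_adj_sym sierp_adj_irr.
End Sierpinski.

Section SierpinskiTriangle.
Variables p n : nat.

(* The non-clique edges of [sierpinski p n.+1]. *)
Definition nonclique : rel (sierpinski p n.+1) := fun x y =>
  [exists l : 'I_n.+1, (1 <= l) && sierp_link l x y].

Fact nonclique_sym : symmetric nonclique.
Proof. by move=> x y; apply: eq_existsb => l; rewrite sierp_link_sym. Qed.

Fact nonclique_sub : subrel nonclique (@adj (sierpinski p n.+1)).
Proof.
move=> x y /existsP[l /andP[_ xy]]; apply/existsP.
by exists (lift ord0 l); rewrite lift0.
Qed.

Definition sierpinski_triangle : sgraph := contract nonclique.
End SierpinskiTriangle.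

(* Main.v *)
Require Import Defs.
From mathcomp Require Import all_boot all_order all_algebra.
From mathcomp Require Import zify lra.
Import Order.TTheory GRing.Theory Num.Theory.
Local Open Scope ring_scope.

Set Implicit Arguments.
Unset Strict Implicit.
Unset Printing Implicit Defensive.

(** Contracting the non-clique edges of [S_p^(n+1)] gives a line graph.  The
    cliques [{w 0, ..., w (p-1)}] are indexed by the words [w] of length [n],
    and the contracted vertices [{s i j^(l+1), s j i^(l+1)}] correspond to the
    edges [{s i j^l, s j i^l}] of [S_p^n] ([edge_vertex]); the [p] extreme
    words [i^(n+1)] stay alone and correspond to pendant edges at the extreme
    vertices [i^n] ([pendant_vertex]).  Two contracted vertices can be adjacent
    only if the corresponding edges share an endpoint ([adj_meets]).

    Hence the edges of a path of [S_p^n], seen as contracted vertices, induce a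
    path.  The graph [S_p^n] has a Hamiltonian path between any two of its
    extreme vertices ([hamiltonian_path]): the copies [a P^(n-1)] are visited
    one after the other, each being crossed from the corner facing the previous
    copy to the corner facing the next one.  Its [p^n - 1] edges together with
    the pendant edges at its two ends induce a path on [p^n + 1] vertices
    ([max_forest_hamiltonian]).

    Finally [p^n + 1] is at least the claimed bound for either parity of [p]:
    both cases follow from
    [p^(n-2) + ... + p + 5 p <= p^(n-1) + 8] ([sum_expn_le]), with equality at
    [n = 3] and [p = 4]. *)

(** * Recognizing forests *)

Section Forests.
Local Open Scope nat_scope.

(** A cycle would contradict the hypothesis at its vertex of maximal rank,
    whose two neighbours on the cycle are distinct. *)
Lemma forest_degenerate (G : sgraph) (r : G -> nat) (X : {set G}) :
  {in X & X & X, forall x y z, adj x y -> adj x z ->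
     r y <= r x -> r z <= r x -> y = z} ->
  forest X.
Proof.
move=> one_below; apply/forestP=> c cyc_c sub_c.
rewrite ltnNge; apply/negP=> c_ge3.
have [x0 x0c] : exists x, x \in c.
  by case: c c_ge3 {cyc_c sub_c} => // x c _; exists x; rewrite inE eqxx.
have [x xc max_x] := arg_maxnP r x0c.
have [k c' def_c] := rot_to xc.
have memc y : y \in x :: c' -> y \in c by rewrite -def_c mem_rot.
move: cyc_c c_ge3; rewrite -(rot_ucycle k) -(size_rot k) def_c.
case: c' memc {def_c} => // y c'; case/lastP: c' => // c' z memc.
rewrite /ucycle /= rcons_path last_rcons => /andP[/and3P[xy _ zx] uniq_c] _.
have yc : y \in c by apply: memc; rewrite !inE eqxx orbT.
have zc : z \in c by apply: memc; rewrite !inE mem_rcons !inE eqxx !orbT.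
have eq_yz : y = z.
  apply: (one_below x) => //; try exact: sub_c; try exact: max_x.
  by rewrite adj_sym.
by move: uniq_c; rewrite eq_yz mem_rcons inE eqxx andbF.
Qed.

(** Adjacency is only bounded from above, so the image may also be a disjoint
    union of paths. *)
Lemma forest_path (G : sgraph) (m : nat) (g : 'I_m -> G) :
  injective g -> (forall a b, adj (g a) (g b) -> a <= b.+1) ->
  forest [set g a | a : 'I_m].
Proof.
move=> g_inj g_adj.
have rank_g a : index (g a) (codom g) = a.
  by rewrite codomE index_map // index_enum_ord.
apply: (@forest_degenerate _ (index^~ (codom g))).
move=> _ _ _ /imsetP[a _ ->] /imsetP[b _ ->] /imsetP[c _ ->] ab ac.
rewrite /= !rank_g => le_ba le_ca; congr g; apply: val_inj => /=.
have ne_ab : a != b :> nat by apply: contraTneq ab => /val_inj ->; rewrite adj_irr.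
have ne_ac : a != c :> nat by apply: contraTneq ac => /val_inj ->; rewrite adj_irr.
by have := g_adj _ _ ab; have := g_adj _ _ ac; move: ne_ab ne_ac; lia.
Qed.

End Forests.

(** * Hamiltonian paths of Sierpinski graphs *)

Section Hamiltonian.
Local Open Scope nat_scope.
Variable p : nat.

Definition extreme n (i : 'I_p) : sierpinski p n := [tuple of nseq n i].

Definition prefix_word n (a : 'I_p) (w : sierpinski p n) : sierpinski p n.+1 :=
  [tuple of a :: w].

Lemma prefix_word_inj n a : injective (@prefix_word n a).
Proof. by move=> w w' /(congr1 val)[] /val_inj. Qed.

Lemma adj_prefix_word n a (w w' : sierpinski p n) :
  adj w w' -> adj (prefix_word a w) (prefix_word a w').
Proof.
move=> /existsP[d /andP[d_gt0 /existsP[i /existsP[j /existsP[s]]]]].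
move=> /and3P[ij /eqP ew /eqP ew'].
have le_dn : d.-1.+1 <= n by rewrite prednK // -ltnS.
have size_s : size (a :: s) == n.+1 - d.-1.+1.
  by rewrite /= size_tuple subSn.
apply/existsP; exists (widen_ord (leqnSn _) d); rewrite d_gt0 /=.
apply/existsP; exists i; apply/existsP; exists j.
by apply/existsP; exists (Tuple size_s); rewrite ij /= ew ew' !eqxx.
Qed.

Lemma adj_extreme n (a b : 'I_p) :
  a != b -> adj (prefix_word a (extreme n b)) (prefix_word b (extreme n a)).
Proof.
move=> ab; apply/existsP; exists ord_max => /=.
apply/existsP; exists a; apply/existsP; exists b.
have size_nil : size ([::] : seq 'I_p) == n.+1 - n.+1 by rewrite subnn.
by apply/existsP; exists (Tuple size_nil); rewrite ab /= !eqxx.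
Qed.

Definition hamiltonian n i j (c : seq (sierpinski p n)) : Prop :=
  [/\ path (@adj _) (extreme n i) c, last (extreme n i) c = extreme n j,
      uniq (extreme n i :: c) & size (extreme n i :: c) = p ^ n].

(** The inductive step, for a tour of the copies with first letters [a :: q]
    that enters copy [a] at its corner [e] and ends at the extreme vertex of
    the last copy.  Copy [a] is crossed from [e] to the letter of the next copy,
    or to [a] itself if it is the last one, and the next copy is then entered at
    its corner [a].  Crossing needs distinct corners: this is what [e \notin q]
    and the condition for [q = [::]] ensure.  The start of the whole tour is the
    case [e = a].  The bound on first letters separates a copy from the later
    ones. *)
Lemma hamiltonian_copies n (a e : 'I_p) (q : seq 'I_p) :
  (forall i j : 'I_p, i != j -> exists c, @hamiltonian n i j c) ->
  uniq (a :: q) -> e \notin q -> (q = [::] -> e != a) ->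
  exists c : seq (sierpinski p n.+1),
    let x := prefix_word a (extreme n e) in
    [/\ path (@adj _) x c, last x c = extreme n.+1 (last a q),
        uniq (x :: c), size (x :: c) = (size q).+1 * p ^ n
      & {in x :: c, forall w, thead w \in a :: q}].
Proof.
move=> ham; elim: q a e => [|b q IHq] a e.
  move=> _ _ /(_ erefl)/ham[c [path_c last_c uniq_c size_c]].
  exists (map (prefix_word a) c) => x; split.
  - by apply: (homo_path (f := prefix_word a)) path_c => ? ?; apply: adj_prefix_word.
  - by rewrite last_map last_c; apply: val_inj.
  - by rewrite -map_cons map_inj_uniq //; apply: prefix_word_inj.
  - by rewrite -map_cons size_map size_c mul1n.
  - by rewrite -map_cons => w /mapP[v _ ->]; rewrite theadE inE.
rewrite cons_uniq => /andP[a_bq uniq_bq] e_bq _.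
have [ne_eb e_q] : e != b /\ e \notin q by move: e_bq; rewrite inE negb_or => /andP.
have [ne_ab a_q] : a != b /\ a \notin q by move: a_bq; rewrite inE negb_or => /andP.
have [c [path_c last_c uniq_c size_c]] := ham _ _ ne_eb.
have [d [path_d last_d uniq_d size_d heads_d]] :=
  IHq b a uniq_bq a_q (fun=> ne_ab).
exists (map (prefix_word a) c ++ prefix_word b (extreme n a) :: d) => x.
rewrite -cat_cons /x -map_cons; split.
- rewrite cat_path (homo_path (f := prefix_word a) (e := @adj _)) //; last first.
    by move=> ? ?; apply: adj_prefix_word.
  by rewrite last_map last_c /= path_d andbT; apply: adj_extreme.
- by rewrite last_cat.
- rewrite cat_uniq map_inj_uniq ?uniq_c ?uniq_d; last exact: prefix_word_inj.
  rewrite andbT; apply/hasPn=> w /heads_d w_bq; apply/mapP=> -[v _ def_w].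
  by move: w_bq; rewrite def_w theadE (negPf a_bq).
- by rewrite size_cat size_map size_c size_d -mulSn.
- move=> w; rewrite mem_cat => /orP[/mapP[v _ ->]|/heads_d w_bq].
    by rewrite theadE inE eqxx.
  by rewrite inE w_bq orbT.
Qed.

Lemma hamiltonian_path n (i j : 'I_p) : i != j -> exists c, @hamiltonian n i j c.
Proof.
elim: n i j => [|n IHn] i j ne_ij.
  by exists [::]; split=> //=; rewrite [RHS]tuple0 [LHS]tuple0.
pose q := rcons [seq k <- enum 'I_p | (k != i) && (k != j)] j.
have uniq_q : uniq (i :: q).
  rewrite /= mem_rcons inE (negPf ne_ij) mem_filter eqxx /=.
  by rewrite rcons_uniq mem_filter eqxx andbF filter_uniq ?enum_uniq.
have size_q : (size q).+1 = p.
  apply: etrans (card_ord p); rewrite -[LHS](card_uniqP uniq_q).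
  apply: eq_card => k; rewrite !inE mem_rcons inE mem_filter mem_enum andbT.
  by case: (k == i); case: (k == j).
have i_q : i \notin q by case/andP: uniq_q.
have nil_q : q = [::] -> i != i by move/(congr1 size); rewrite size_rcons.
have [c [path_c last_c uniq_c size_c _]] := hamiltonian_copies IHn uniq_q i_q nil_q.
have eq_x : prefix_word i (extreme n i) = extreme n.+1 i by apply: val_inj.
rewrite /hamiltonian; exists c; split; rewrite -?eq_x //.
- by rewrite last_c last_rcons.
- by rewrite size_c size_q -expnS.
Qed.
End Hamiltonian.

(** * The contracted graph as a line graph *)

Section LineGraph.
Local Open Scope nat_scope.
Variables p n : nat.

Local Notation word := (sierpinski p n.+1).
Local Notation triangle := (sierpinski_triangle p n).

Lemma rcons_nseq (T : Type) k (a : T) : rcons (nseq k a) a = nseq k.+1 a.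
Proof. by elim: k => //= k ->. Qed.

Lemma nseq_cat_inj (T : eqType) (j i i' : T) k l (s s' : seq T) :
  i != j -> i' != j -> nseq k j ++ i :: s = nseq l j ++ i' :: s' ->
  [/\ k = l, i = i' & s = s'].
Proof.
move=> ij i'j; elim: k l => [|k IHk] [|l] //=.
- by case=> -> ->.
- by case=> eij; rewrite eij eqxx in ij.
- by case=> eij; rewrite -eij eqxx in i'j.
- by case=> /IHk[-> -> ->].
Qed.

(** Non-clique edges form a matching: reversing [s i j^l] exhibits [j], [l] and
    [i] as its last letter, the length of its last run and the letter before
    that run.  So the contracted components have at most two elements. *)
Lemma nonclique_functional (x y z : word) :
  nonclique x y -> nonclique x z -> y = z.
Proof.
move=> /existsP[k /andP[k_gt0 /existsP[i /existsP[j /existsP[s /and3P[ij]]]]]].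
move=> /eqP ex /eqP ey.
move=> /existsP[l /andP[l_gt0 /existsP[i' /existsP[j' /existsP[s' /and3P[ij']]]]]].
rewrite ex => /eqP es /eqP ez.
have rev_es := congr1 rev es.
rewrite !rev_cat !rev_cons !rev_nseq !cat_rcons in rev_es.
have ej : j = j'.
  have head_nseq (a b : 'I_p) m r : 0 < m -> head b (nseq m a ++ r) = a by case: m.
  by have := congr1 (head j) rev_es; rewrite !head_nseq.
rewrite -ej in rev_es ij' ez.
have [ek ei /(can_inj revK) e_s] := nseq_cat_inj ij ij' rev_es.
by apply: val_inj; rewrite /= ey ez e_s ei ek.
Qed.

Lemma nonclique_extreme i (y : word) : ~~ nonclique (extreme n.+1 i) y.
Proof.
apply/existsP=> -[k /andP[k_gt0 /existsP[a /existsP[b /existsP[s /and3P[ab]]]]]].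
move=> /eqP es _.
have mem_i c : c \in val s ++ a :: nseq k b -> c = i.
  by rewrite -es mem_nseq => /eqP.
have a_i : a = i by apply: mem_i; rewrite mem_cat inE eqxx orbT.
have b_i : b = i by apply: mem_i; rewrite mem_cat inE mem_nseq k_gt0 eqxx !orbT.
by move: ab; rewrite a_i b_i eqxx.
Qed.

Definition class (x : word) : triangle :=
  exist _ [set y in [set: word] | connect (@nonclique p n) x y]
    (imset_f (fun x => [set y in [set: word] | connect (@nonclique p n) x y])
       (in_setT x)).

Lemma mem_class (x y : word) : (y \in val (class x)) = (y == x) || nonclique x y.
Proof.
rewrite /= !inE /=; apply/idP/idP; last first.
  by case/orP=> [/eqP->|]; [apply: connect0 | apply: connect1].
pose A := [pred z | (z == x) || nonclique x z].
have closed_A : closed (@nonclique p n) A.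
  move=> u v uv; rewrite !inE; apply/idP/idP.
    case/orP=> [/eqP<-|xu]; first by rewrite uv orbT.
    by rewrite nonclique_sym in xu; rewrite (nonclique_functional uv xu) eqxx.
  rewrite nonclique_sym in uv.
  case/orP=> [/eqP<-|xv]; first by rewrite uv orbT.
  by rewrite nonclique_sym in xv; rewrite (nonclique_functional uv xv) eqxx.
move=> /(closed_connect closed_A) eq_A; suff : y \in A by [].
by rewrite -eq_A inE eqxx.
Qed.

Lemma triangle_vertex (C : triangle) : exists x, C = class x.
Proof. by case: C => C CP; case/imsetP: (CP) => x _ eC; exists x; apply: val_inj. Qed.

(** [C], seen as an edge of [S_p^n], is incident to [w]. *)
Definition meets (w : sierpinski p n) (C : triangle) : bool :=
  [exists a : 'I_p, [tuple of rcons w a] \in val C].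

Lemma adj_meets (C D : triangle) : adj C D -> exists2 w, meets w C & meets w D.
Proof.
case/andP=> ne_CD /exists_inP[x xC /exists_inP[y yD]].
case/existsP=> -[[|l] lt_l] /andP[//= _ xy].
case: l lt_l xy => [|l] lt_l xy.
  case/existsP: xy => i /existsP[j /existsP[s /and3P[_ /eqP ex /eqP ey]]].
  have size_s : size s == n by rewrite size_tuple subn1.
  exists (Tuple size_s); apply/existsP.
    by exists i; rewrite (_ : [tuple of _] = x) //; apply: val_inj; rewrite /= ex cats1.
  by exists j; rewrite (_ : [tuple of _] = y) //; apply: val_inj; rewrite /= ey cats1.
have nc_xy : nonclique x y by apply/existsP; exists (Ordinal (lt_l : l.+1 < n.+1)).
have [[u eC] [v eD]] := (triangle_vertex C, triangle_vertex D).
case/eqP: ne_CD; rewrite eC eD in xC yD *; apply: val_inj.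
have cs : connect_sym (@nonclique p n) by apply/sym_connect_sym/nonclique_sym.
have uv : connect (@nonclique p n) u v.
  move: xC yD; rewrite /= !inE /= => ux vy.
  by rewrite (connect_trans ux) // (connect_trans (connect1 nc_xy)) // cs.
by apply/setP=> z; rewrite !inE /=; apply: same_connect cs _ _ uv _.
Qed.

Lemma rcons_tuple_eq (w w' : sierpinski p n) (a b : 'I_p) :
  ([tuple of rcons w a] == [tuple of rcons w' b] :> word) = (w == w') && (a == b).
Proof. by rewrite -!val_eqE /= eqseq_rcons. Qed.

Lemma edge_vertex (w w' : sierpinski p n) :
  adj w w' -> exists C, forall v, meets v C = (v == w) || (v == w').
Proof.
case/existsP=> -[[|l] lt_l] /andP[//= _].
move=> /existsP[i /existsP[j /existsP[s /and3P[ij /eqP ew /eqP ew']]]].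
pose x : word := [tuple of rcons w j]; pose y : word := [tuple of rcons w' i].
have nc_xy : nonclique x y.
  apply/existsP; exists (Ordinal (lt_l : l.+1 < n.+1)); rewrite /=.
  apply/existsP; exists i; apply/existsP; exists j; apply/existsP; exists s.
  by rewrite ij /= ew ew' !rcons_cat !rcons_cons !rcons_nseq !eqxx.
exists (class x) => v.
have def_class z : (z \in val (class x)) = (z == x) || (z == y).
  rewrite mem_class; congr (_ || _); apply/idP/eqP=> [xz|->//].
  exact: nonclique_functional xz nc_xy.
apply/existsP/idP => [[a]|].
  by rewrite def_class !rcons_tuple_eq => /orP[] /andP[->]; rewrite ?orbT.
case/orP=> /eqP->; [exists j | exists i];
  by rewrite def_class !rcons_tuple_eq !eqxx ?orbT.
Qed.

Lemma pendant_vertex i : exists C, forall v, meets v C = (v == extreme n i).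
Proof.
exists (class (extreme n.+1 i)) => v.
have eq_ext : extreme n.+1 i = [tuple of rcons (extreme n i) i] :> word.
  by apply: val_inj; rewrite /= rcons_nseq.
have def_class z : (z \in val (class (extreme n.+1 i))) = (z == extreme n.+1 i).
  by rewrite mem_class (negPf (nonclique_extreme _ _)) orbF.
apply/existsP/idP => [[a]|/eqP->].
  by rewrite def_class eq_ext rcons_tuple_eq => /andP[].
by exists i; rewrite def_class eq_ext.
Qed.

(** The vertices of the path are told apart by the words they meet; when
    [n = 0], the two pendant edges share their only endpoint. *)
Lemma max_forest_hamiltonian (i j : 'I_p) :
  i != j -> 0 < n -> p ^ n < max_forest triangle.
Proof.
move=> ne_ij n_gt0.
have [c [path_c last_c uniq_c size_c]] := hamiltonian_path n ne_ij.
set ws := extreme n i :: c in uniq_c size_c.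
pose N := p ^ n; have size_ws : size ws = N by [].
have all_ws w : w \in ws.
  have /subset_cardP/(_ (subset_predT _))-> // : #|ws| = #|sierpinski p n|.
  by rewrite (card_uniqP uniq_c) size_c card_tuple card_ord.
have N_ge2 : 1 < N.
  have p_gt1 : 1 < p.
    by move: ne_ij; rewrite -val_eqE /=; have := ltn_ord i; have := ltn_ord j; lia.
  exact: leq_ltn_trans n_gt0 (ltn_expl n p_gt1).
have index_lt w : index w ws < N by rewrite -size_ws index_mem.
have nth_index_eq w m : m < N -> (w == nth (extreme n i) ws m) = (index w ws == m).
  move=> lt_m; apply/eqP/eqP => [->|<-]; last by rewrite nth_index.
  by rewrite index_uniq // size_ws.
have vertex_at (k : 'I_N.+1) : exists C : triangle, forall w,
    meets w C = (index w ws == k) || ((index w ws).+1 == k).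
  (* The k-th vertex is the edge from the word of index k - 1 to that of index
     k; for k = 0 and k = N one of these words is missing. *)
  case: (posnP k) => [->|k_gt0].
    have [C CP] := pendant_vertex i; exists C => w.
    by rewrite CP (nth_index_eq _ 0) ?orbF //; lia.
  have [lt_k|le_N] := ltnP k N; last first.
    have [C CP] := pendant_vertex j; exists C => w.
    have last_ws : extreme n j = nth (extreme n i) ws N.-1.
      by rewrite -last_c -size_ws nth_last.
    have := index_lt w; have := ltn_ord k.
    by rewrite CP last_ws nth_index_eq; lia.
  have lt_k1 : k.-1 < size c by rewrite -ltnS prednK // [X in _ < X]size_ws.
  have /pathP-/(_ (extreme n i) k.-1 lt_k1) := path_c.
  case/edge_vertex=> C CP; exists C => w; rewrite CP -/ws.
  rewrite (_ : nth _ c k.-1 = nth (extreme n i) ws k); last by rewrite -(prednK k_gt0).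
  by rewrite !nth_index_eq; lia.
have [g gP] := fin_all_exists vertex_at.
have g_inj : injective g.
  move=> a b eq_ab; apply: val_inj => /=.
  have test m : m < N -> (m == a) || (m.+1 == a) = (m == b) || (m.+1 == b).
    move=> lt_m; have := gP a (nth (extreme n i) ws m).
    by rewrite eq_ab gP index_uniq // size_ws.
  (* If a < b, then b = a + 1 by the test at a.  The test at a - 1 refutes
     this unless a = 0; then b = 1 < N and the test at b refutes it. *)
  have lt_a := ltn_ord a; have lt_b := ltn_ord b.
  have := test a; have := test b; have := test a.-1; have := test b.-1.
  lia.
have g_adj a b : adj (g a) (g b) -> a <= b.+1.
  by case/adj_meets=> w; rewrite !gP; lia.
have := forest_path g_inj g_adj => forest_g.
have := leq_bigmax_cond (F := fun X : {set triangle} => #|X|) _ forest_g.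
by rewrite card_imset // card_ord.
Qed.
End LineGraph.

(** * The numerical bound *)

Lemma sum_expn_le (n p : nat) : (3 <= n)%N -> (4 <= p)%N ->
  (\sum_(1 <= i < n.-1) p ^ i + 5 * p <= p ^ n.-1 + 8)%N.
Proof.
move=> n_ge3 p_ge4; case: n n_ge3 => [|[|[|n]]] //= _.
elim: n => [|n IHn]; first by rewrite big_nat1 expn1 expnS expn1; nia.
rewrite big_nat_recr //= [(p ^ n.+3)%N]expnS.
have : (p <= p ^ n.+2)%N by rewrite expnS leq_pmulr // expn_gt0; lia.
by move: IHn; nia.
Qed.

Theorem theorem4p1 (n p : nat) (hn : (3 <= n)%N) (hp : (4 <= p)%N) :
  let q : rat := p%:R in
  let f : rat := (max_forest (sierpinski_triangle p n))%:R in
  if odd p then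
    f >= q ^+ n - (q ^+ n.-1 + q ^+ n.-2 - 5 * q + 3) / 8
  else
    f >= q ^+ n - q ^+ n.-1 / 8 + (\sum_(1 <= i < n.-1) q ^+ i) / 8
         + 5 * q / 8.
Proof.
cbv zeta; set q : rat := p%:R; set f : rat := (max_forest _)%:R.
have [i [j ne_ij]] : exists i j : 'I_p, i != j.
  have [p_gt0 p_gt1] : (0 < p /\ 1 < p)%N by lia.
  by exists (Ordinal p_gt0), (Ordinal p_gt1).
have f_ge : q ^+ n + 1 <= f.
  rewrite /q /f -natrX -(natrD _ _ 1) ler_nat addn1.
  by apply: max_forest_hamiltonian ne_ij _; lia.
have sum_le : \sum_(1 <= i < n.-1) q ^+ i + 5 * q <= q ^+ n.-1 + 8.
  under eq_bigr do rewrite /q -natrX.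
  rewrite -natr_sum /q -natrX -natrM -!natrD ler_nat.
  exact: sum_expn_le.
case: ifP => _; last by lra.
have q_ge0 : 0 <= q by rewrite ler0n.
have sum_ge0 : 0 <= \sum_(1 <= i < n.-1) q ^+ i.
  by apply: sumr_ge0 => k _; apply: exprn_ge0.
have pow_ge0 : 0 <= q ^+ n.-2 by apply: exprn_ge0.
lra.
Qed.
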